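(* Let $X$ be a set, let $\mathbb{F}$ be a field, and let $K, Q : X^2 \to \mathbb{F}$ be symmetric kernels, i.e. functions with $K(x,y)=K(y,x)$ and $Q(x,y)=Q(y,x)$ for all $x,y\in X$. Then $K$ and $Q$ are equivalent, i.e. \[\det(K(x_i,x_j))_{i,j=1}^n = \det(Q(x_i,x_j))_{i,j=1}^n \quad \text{for all integers } n>0 \text{ and all tuples } (x_1,\dots,x_n)\in X^n,\] if and only if there is a function $g: X\to \{\pm 1\}\subseteq \mathbb{F}$ such that \[Q(x,y)=g(x)\,g(y)^{-1}K(x,y)\qquad \text{for all } x,y\in X.\]
   Context: The field $\mathbb{F}$ is arbitrary (any characteristic, including characteristic 2, in which case $1=-1$). The set $X$ is arbitrary and carries no additional structure. Kernels are simply functions $X^2\to\mathbb{F}$. The tuples $(x_1,\dots,x_n)$ are arbitrary (entries may repeat). *)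

(* Defs.v *)
From mathcomp Require Import all_boot all_algebra.

Set Implicit Arguments.
Unset Strict Implicit.
Unset Printing Implicit Defensive.

Import GRing.Theory.
Local Open Scope ring_scope.

Definition symmetric_kernel (X : Type) (F : fieldType) (K : X -> X -> F) : Prop :=
  forall x y : X, K x y = K y x.

Definition kernel_matrix (X : Type) (F : fieldType) (K : X -> X -> F)
    (n : nat) (x : n.-tuple X) : 'M[F]_n :=
  \matrix_(i < n, j < n) K (tnth x i) (tnth x j).

Definition equivalent_kernels (X : Type) (F : fieldType)
    (K Q : X -> X -> F) : Prop :=
  forall (n : nat) (x : n.-tuple X), (0 < n)%N ->
    \det (kernel_matrix K x) = \det (kernel_matrix Q x).

(* Main.v *)
Require Import Defs.
From mathcomp Require Import all_boot all_algebra.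
From mathcomp Require Import fingroup perm ring zify.
From Stdlib Require Import ClassicalEpsilon FunctionalExtensionality.
From Stdlib Require Import PropExtensionality.

(** Conjugating by a diagonal matrix does not change determinants, which is the
    easy implication ([det_conj_kernel]).

    Conversely, principal minors of sizes 1 and 2 determine [K x x] and
    [K x y ^+ 2], so [Q x y] is [K x y] up to a sign for all [x] and [y].  These
    signs have the form [g x / g y] as soon as, around every closed walk, the
    products of the values of [K] and of [Q] agree ([closed_walk_weight]): in
    each connected component of the graph of pairs with [K x y != 0], [g] is
    then the ratio of the [Q]- and [K]-weights of any walk from a base point
    ([equivalent_signs]).

    Agreement on closed walks goes by strong induction on the length.  If two
    nodes [y], [z] that are not neighbours on the walk satisfy [K y z != 0],
    this chord cuts the walk into two shorter closed ones, whose weights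
    multiply to the weight of the walk times [K y z ^+ 2]; this square is the
    same for [K] and [Q].  If there is no such chord, the matrix of the walk is
    supported on a cycle, and in the Leibniz expansion of its determinant only
    involutions and the two rotations survive ([band_permP]).  Involutions
    contribute products of diagonal entries and of squares, equal for [K] and
    [Q], so equality of determinants says that twice the weights agree
    ([cycle_prod_eq]).  In characteristic 2 one cannot divide by 2, but there
    equality of squares already gives [K = Q].

    Nodes of a walk may repeat and chords may be loops: a chord is a pair of
    positions.  This spares any reduction to simple cycles. *)

Set Implicit Arguments.
Unset Strict Implicit.
Unset Printing Implicit Defensive.

Import GRing.Theory.
Local Open Scope ring_scope.

(** * Permutations of a cycle that move points by at most one step *)

(** A point that moves one step [d] without being swapped back forces the next
    point to move by [d] as well: it can neither stay nor return, as those
    images are already taken.  Stated for [d] so as to cover both directions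
    of rotation. *)
Lemma shift_propagates (V : zmodType) (s : V -> V) (d i : V) :
  injective s -> d != 0 -> d + d != 0 ->
  (forall j, [\/ s j = j - d, s j = j | s j = j + d]) ->
  s i = i + d -> s (s i) != i -> forall k, s (i + d *+ k) = i + d *+ k + d.
Proof.
move=> s_inj d0 dd0 band si ssi k.
suff [] : s (i + d *+ k) = i + d *+ k + d /\
          s (i + d *+ k + d) = i + d *+ k + d + d by [].
have step j : s j = j + d -> s (j + d) != j -> s (j + d) = j + d + d.
  move=> sj sjd; case: (band (j + d)) => // e.
    by rewrite e addrK eqxx in sjd.
  have /s_inj/eqP : s j = s (j + d) by rewrite e.
  by rewrite -{1}[j]addr0 (inj_eq (addrI _)) eq_sym (negbTE d0).
(* Two consecutive shifts are carried along, as [step] needs [s (j + d) != j]. *)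
elim: k => [|k [IH1 IH2]].
  by rewrite mulr0n addr0; split=> //; apply: step; rewrite // -si.
rewrite mulrSr addrA; split=> //; apply: step => //.
apply/eqP=> e; have /s_inj/eqP : s (i + d *+ k) = s (i + d *+ k + d + d).
  by rewrite e IH1.
set j := i + _; rewrite -addrA -{1}[j]addr0 (inj_eq (addrI _)) eq_sym.
by rewrite (negbTE dd0).
Qed.

Lemma band_permP m (s : {perm 'I_m.+3}) :
  (forall i, [\/ s i = i, s i = i + 1 | i = s i + 1]) ->
  [\/ forall i, s (s i) = i, forall i, s i = i + 1 | forall i, s i = i - 1].
Proof.
move=> band.
have [/forallP inv|] := boolP [forall i, s (s i) == i].
  by constructor 1 => i; apply/eqP.
rewrite negb_forall => /existsP[i nssi].
have one0 : (1 : 'I_m.+3) != 0 by [].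
have two0 : (1 + 1 : 'I_m.+3) != 0 by [].
have [si|si|si] := band i.
- by rewrite !si eqxx in nssi.
- constructor 2 => j.
  have bandP k : [\/ s k = k - 1, s k = k | s k = k + 1].
    have [e|e|e] := band k; [by constructor 2|by constructor 3|].
    by constructor 1; rewrite {2}e addrK.
  have := shift_propagates (@perm_inj _ s) one0 two0 bandP si nssi (j - i)%R.
  by rewrite natr_Zp subrKC.
- constructor 3 => j.
  have bandN k : [\/ s k = k - -1, s k = k | s k = k + -1].
    have [e|e|e] := band k; [by constructor 2|by constructor 1; rewrite opprK|].
    by constructor 3; rewrite {2}e addrK.
  have si' : s i = i + -1 by rewrite {2}si addrK.
  have mone0 : (-1 : 'I_m.+3) != 0 by rewrite oppr_eq0.
  have mtwo0 : (-1 + -1 : 'I_m.+3) != 0 by rewrite -opprD oppr_eq0.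
  have := shift_propagates (@perm_inj _ s) mone0 mtwo0 bandN si' nssi (i - j)%R.
  by rewrite mulNrn natr_Zp opprB subrKC.
Qed.

(** * Determinants of symmetric matrices supported on a cycle *)

(** Grouping the two factors of each 2-cycle makes the product depend only on
    the diagonal and on the squares of the entries. *)
Lemma prod_involution (R : comPzRingType) n (A : 'M[R]_n) (s : {perm 'I_n}) :
  (forall i j, A i j = A j i) -> (forall i, s (s i) = i) ->
  \prod_i A i (s i) =
    (\prod_(i | s i == i) A i i) * \prod_(i < n | (i < s i)%N) A i (s i) ^+ 2.
Proof.
move=> symA inv.
rewrite (bigID (fun i => s i == i)) /=; congr (_ * _).
  by apply: eq_bigr => i /eqP ->.
rewrite (bigID (fun i : 'I_n => (i < s i)%N)) /=.
rewrite (eq_bigl (fun i : 'I_n => i < s i)%N); last first.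
  by move=> i; rewrite -val_eqE /=; case: ltngtP.
rewrite [X in _ * X](reindex_inj (@perm_inj _ s)) /=.
rewrite [X in _ * X](eq_bigl (fun i : 'I_n => i < s i)%N); last first.
  by move=> i; rewrite inv -val_eqE /=; case: ltngtP.
by rewrite -big_split; apply: eq_bigr => i _; rewrite inv /= (symA (s i)) expr2.
Qed.

(** The rotations [i |-> i + 1] and [i |-> i - 1] are distinct (the size is at
    least 3), have the same sign, and contribute the same product by symmetry.
    All other terms of the two determinants cancel, which leaves twice the
    difference of the two products. *)
Lemma cycle_prod_eq (F : fieldType) m (A B : 'M[F]_m.+3) :
  (2%:R : F) != 0 ->
  (forall i j, A i j = A j i) -> (forall i j, B i j = B j i) ->
  (forall i, A i i = B i i) -> (forall i j, A i j ^+ 2 = B i j ^+ 2) ->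
  (forall i j, A i j != 0 -> [\/ j = i, j = i + 1 | i = j + 1]) ->
  \det A = \det B -> \prod_i A i (i + 1) = \prod_i B i (i + 1).
Proof.
move=> two0 symA symB diag sq band /eqP.
rewrite -subr_eq0 /determinant -sumrB.
pose c : {perm 'I_m.+3} := perm (@addIr _ (1 : 'I_m.+3)).
have cE i : c i = i + 1 by rewrite permE.
have cVE i : (c^-1)%g i = i - 1.
  by apply: (@perm_inj _ c); rewrite permKV cE subrK.
have cVc : (c^-1)%g != c.
  apply/eqP => /permP /(_ 0); rewrite cE cVE => /eqP.
  by rewrite !add0r eq_sym -subr_eq0 opprK.
have prodV (M : 'M[F]_m.+3) : (forall i j, M i j = M j i) ->
    \prod_i M i ((c^-1)%g i) = \prod_i M i (i + 1).
  move=> symM; rewrite (reindex_inj (@addIr _ (1 : 'I_m.+3))) /=.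
  by apply: eq_bigr => i _; rewrite cVE addrK.
have prodc (M : 'M[F]_m.+3) : \prod_i M i (c i) = \prod_i M i (i + 1).
  by apply: eq_bigr => i _; rewrite cE.
rewrite (bigD1 c) //= (bigD1 (c^-1)%g cVc) /= [X in _ + (_ + X)]big1 => [|s /andP[nc ncV]].
  rewrite odd_permV !prodc !prodV // addr0 -mulrBr -mulr2n -mulr_natl.
  by rewrite !mulf_eq0 signr_eq0 (negbTE two0) /= subr_eq0 => /eqP.
rewrite -mulrBr; apply/eqP; rewrite mulf_eq0 subr_eq0; apply/orP; right.
have [/forallP sup|] := boolP [forall i, A i (s i) != 0].
  have [i|inv|sc|scV] := @band_permP _ s; first exact: band.
  - rewrite !prod_involution //; apply/eqP; congr (_ * _); apply: eq_bigr => //.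
  - by case/negP: nc; apply/eqP/permP => i; rewrite sc cE.
  - by case/negP: ncV; apply/eqP/permP => i; rewrite scV cVE.
rewrite negb_forall => /existsP[i]; rewrite negbK => /eqP Ai.
have Bi : B i (s i) = 0 by apply/eqP; rewrite -sqrf_eq0 -sq Ai expr0n.
by rewrite (bigD1 i) //= [X in _ == X](bigD1 i) //= Ai Bi !mul0r.
Qed.

(** * Weights of walks *)

Fixpoint walk_weight (X : Type) (R : pzRingType) (K : X -> X -> R) x u : R :=
  if u is y :: v then K x y * walk_weight K y v else 1.

Lemma walk_weight_cat X (R : pzRingType) (K : X -> X -> R) x u v :
  walk_weight K x (u ++ v) = walk_weight K x u * walk_weight K (last x u) v.
Proof. by elim: u x => [|y u IH] x /=; rewrite ?mul1r // IH mulrA. Qed.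

Lemma walk_weight_prod X (R : pzRingType) (K : X -> X -> R) x0 x u :
  walk_weight K x u =
    \prod_(i < size u) K (nth x0 (x :: u) i) (nth x0 u i).
Proof.
elim: u x => [|y u IH] x /=; first by rewrite big_ord0.
by rewrite big_ord_recl IH.
Qed.

Lemma walk_weight_sqr X (R : comPzRingType) (K Q : X -> X -> R) x u :
  (forall x y, K x y ^+ 2 = Q x y ^+ 2) ->
  walk_weight K x u ^+ 2 = walk_weight Q x u ^+ 2.
Proof. by move=> sq; elim: u x => //= y u IH x; rewrite !exprMn sq IH. Qed.

(** * Small principal minors *)

Lemma det2 (R : comPzRingType) (A : 'M[R]_2) :
  \det A = A 0 0 * A 1 1 - A 0 1 * A 1 0.
Proof.
rewrite (expand_det_row _ 0) !big_ord_recl big_ord0 /cofactor !det_mx11 !mxE.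
have -> : lift 0 0 = 1 :> 'I_2 by apply: val_inj.
have -> : lift 1 0 = 0 :> 'I_2 by apply: val_inj.
by rewrite /= expr0 expr1 addr0 mul1r mulN1r mulrN.
Qed.

Lemma equivalent_diag X (F : fieldType) (K Q : X -> X -> F) x :
  equivalent_kernels K Q -> K x x = Q x x.
Proof. by move/(_ 1%N [tuple x] isT); rewrite !det_mx11 !mxE. Qed.

Lemma equivalent_sqr X (F : fieldType) (K Q : X -> X -> F) x y :
  symmetric_kernel K -> symmetric_kernel Q -> equivalent_kernels K Q ->
  K x y ^+ 2 = Q x y ^+ 2.
Proof.
move=> symK symQ eqKQ; have := eqKQ _ [tuple x; y] isT.
rewrite !det2 !mxE !(tnth_nth x) /= !(equivalent_diag _ eqKQ).
by rewrite (symK y) (symQ y) => /addrI /oppr_inj; rewrite !expr2.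
Qed.

(** * Closed walks *)

Lemma chordless_closed_walk X (F : fieldType) (K Q : X -> X -> F) x u m :
  symmetric_kernel K -> symmetric_kernel Q -> equivalent_kernels K Q ->
  (2%:R : F) != 0 -> size u = m.+3 -> last x u = x ->
  (forall i j, (i.+2 <= j)%N -> (j < size u)%N -> (j.+2 <= size u + i)%N ->
     K (nth x (x :: u) i) (nth x (x :: u) j) = 0) ->
  walk_weight K x u = walk_weight Q x u.
Proof.
move=> symK symQ eqKQ two0 szu lastu chordless.
pose t := [tuple nth x (x :: u) i | i < m.+3].
have weightE R : walk_weight R x u = \prod_i kernel_matrix R t i (i + 1).
  rewrite (walk_weight_prod _ x) szu; apply: eq_bigr => i _.
  rewrite mxE !tnth_mktuple; congr (R _ _).
  (* The walk returns to its start: node number [size u] is node 0 of the cycle. *)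
  have [lti|] := ltnP i.+1 m.+3.
    by rewrite /= modn_small addn1.
  move=> lei; have ei : i = m.+2 :> nat by have := ltn_ord i; lia.
  rewrite /= ei addn1 modnn /= -[RHS]lastu -nth_last szu.
  by apply: set_nth_default; rewrite szu.
rewrite !weightE; apply: cycle_prod_eq => //.
- by move=> i j; rewrite !mxE symK.
- by move=> i j; rewrite !mxE symQ.
- by move=> i; rewrite !mxE; apply: equivalent_diag.
- by move=> i j; rewrite !mxE; apply: equivalent_sqr.
(* Two positions that are not cyclic neighbours form a chord. *)
- have near (i j : 'I_m.+3) : (i < j)%N ->
      K (nth x (x :: u) i) (nth x (x :: u) j) != 0 -> j = i + 1 \/ i = j + 1.
    move=> ltij; have ltj := ltn_ord j.
    have [lt2 |le2] := ltnP i.+1 j; last first.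
      left; apply: val_inj; rewrite /= addn1 modn_small; lia.
    have [lt3 |le3] := leqP j.+2 (size u + i).
      by rewrite chordless ?eqxx // szu.
    right; apply: val_inj.
    have jE : j = m.+2 :> nat by lia.
    by rewrite /= jE addn1 modnn; lia.
  move=> i j; rewrite mxE !tnth_mktuple.
  have [ltij|ltji|/val_inj ->] := ltngtP i j; last by constructor 1.
    by move=> /near[] // ->; [constructor 2|constructor 3].
  by rewrite symK => /near[] // ->; [constructor 3|constructor 2].
- exact: eqKQ.
Qed.

Lemma walk_split X (x : X) u i j : (i <= j)%N -> (j <= size u)%N ->
  exists u1 u2 u3, [/\ u = u1 ++ u2 ++ u3, size u1 = i, size u2 = (j - i)%N,
    last x u1 = nth x (x :: u) i & last (last x u1) u2 = nth x (x :: u) j].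
Proof.
move=> leij leju; exists (take i u), (take (j - i) (drop i u)), (drop j u).
have szi : size (take i u) = i by rewrite size_takel //; lia.
have ej : take i u ++ take (j - i) (drop i u) = take j u.
  by rewrite -takeD subnKC.
have lastt k : (k <= size u)%N -> last x (take k u) = nth x (x :: u) k.
  move=> lek; rewrite (last_nth x) size_takel //.
  by rewrite -[x :: take k u]/(take k.+1 (x :: u)) nth_take.
split=> //; rewrite ?catA ?ej ?cat_take_drop //.
- by rewrite size_takel // size_drop; lia.
- by apply: lastt; lia.
- by rewrite -last_cat ej lastt.
Qed.

(** The chord between positions [i < j] closes up the segment between them, and
    replaces it in the rest of the walk.  Both closed walks are strictly shorter
    exactly when [i] and [j] are not cyclic neighbours. *)
Lemma closed_walk_weight X (F : fieldType) (K Q : X -> X -> F) x u :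
  symmetric_kernel K -> symmetric_kernel Q -> equivalent_kernels K Q ->
  last x u = x -> walk_weight K x u = walk_weight Q x u.
Proof.
move=> symK symQ eqKQ.
have sq y z := equivalent_sqr y z symK symQ eqKQ.
have [two0|two0] := eqVneq (2%:R : F) 0.
  move=> _; elim: u x => //= y u IH x; rewrite IH; congr (_ * _).
  have /eqP := sq x y; rewrite eqf_sqr => /orP[] /eqP // ->.
  by apply/eqP; rewrite eq_sym -addr_eq0 -mulr2n -mulr_natl two0 mul0r.
have [n] := ubnP (size u); elim: n => // n IH in x u *; rewrite ltnS => leun lastu.
case szu : (size u) => [|[|[|m]]].
- by move/size0nil: szu => ->.
- case: u szu lastu {leun} => [|y [|//]] //= _ ->.
  by rewrite (equivalent_diag _ eqKQ).
- case: u szu lastu {leun} => [|y [|z [|//]]] //= _ ->.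
  by rewrite (symK y) (symQ y) !mulr1 -!expr2 sq.
pose node := nth x (x :: u).
have [/existsP[i /existsP[j]]|] := boolP
  [exists i : 'I_(size u), exists j : 'I_(size u),
   [&& (i.+2 <= j)%N, (j.+2 <= size u + i)%N & K (node i) (node j) != 0]];
  last first.
  rewrite negb_exists => /forallP nochord.
  apply: (chordless_closed_walk symK symQ eqKQ two0 szu lastu) => i j leij ltj lej.
  have lti : (i < size u)%N by lia.
  have := nochord (Ordinal lti); rewrite negb_exists.
  by move=> /forallP/(_ (Ordinal ltj)); rewrite /= leij lej negbK => /eqP.
case/and3P => leij lej; have ltj := ltn_ord j; rewrite /node.
have [||u1 [u2 [u3 [eu sz1 sz2 <- <-]]]] := @walk_split X x u i j; [lia|lia|].
set y := last x u1; set z := last y u2 => Kyz.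
have szE : size u = (size u1 + size u2 + size u3)%N.
  by rewrite eu !size_cat addnA.
have lastz : last z u3 = x by rewrite -lastu eu !last_cat.
have IHA : walk_weight K y (rcons u2 y) = walk_weight Q y (rcons u2 y).
  by apply: IH; rewrite ?last_rcons // size_rcons; lia.
have IHB : walk_weight K x (u1 ++ z :: u3) = walk_weight Q x (u1 ++ z :: u3).
  by apply: IH; rewrite ?last_cat //= size_cat /=; lia.
apply: (mulIf (expf_neq0 2 Kyz)); rewrite [in RHS]sq.
have splitE R : symmetric_kernel R -> walk_weight R x u * R y z ^+ 2 =
    walk_weight R y (rcons u2 y) * walk_weight R x (u1 ++ z :: u3).
  move=> symR; rewrite eu -cats1 !walk_weight_cat /= -/y -/z (symR z y); ring.
by rewrite !splitE // IHA IHB.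
Qed.

(** * Sign functions *)

(** Connectedness in the graph whose edges are the pairs where [K] does not
    vanish, loops included. *)
Definition joined X (F : fieldType) (K : X -> X -> F) x y :=
  exists u, last x u = y /\ walk_weight K x u != 0.

Lemma joined_trans X (F : fieldType) (K : X -> X -> F) y x z :
  joined K x y -> joined K y z -> joined K x z.
Proof.
move=> [u [ux wu]] [v [vz wv]]; exists (u ++ v).
by rewrite last_cat walk_weight_cat ux mulf_neq0.
Qed.

Lemma joined_edge X (F : fieldType) (K : X -> X -> F) x y :
  K x y != 0 -> joined K x y.
Proof. by move=> Kxy; exists [:: y]; rewrite /= mulr1. Qed.

Lemma joined_sym X (F : fieldType) (K : X -> X -> F) x y :
  symmetric_kernel K -> joined K x y -> joined K y x.
Proof.
move=> symK [u []]; elim: u x => [|z u IH] x /= lastu.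
  by move=> _; exists [::]; rewrite lastu oner_neq0.
rewrite mulf_eq0 => /norP[Kxz wu]; apply: (joined_trans (IH z lastu wu)).
by apply: joined_edge; rewrite symK.
Qed.

(** The chosen base point of the component of [x] depends on [x] only through
    the predicate of being joined to [x], hence is constant on components by
    extensionality. *)
Lemma joined_root X (F : fieldType) (K : X -> X -> F) :
  symmetric_kernel K ->
  exists r : X -> X, (forall x, joined K (r x) x) /\
                     (forall x y, joined K x y -> r x = r y).
Proof.
move=> symK; exists (fun x => epsilon (inhabits x) (fun r => joined K r x)).
split=> [x|x y Jxy].
  apply: (epsilon_spec (inhabits x) (fun r => joined K r x)).
  by exists x, [::]; rewrite oner_neq0.
have -> : (fun r => joined K r x) = (fun r => joined K r y).
  apply: functional_extensionality => r; apply: propositional_extensionality.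
  split=> Jr; [exact: joined_trans Jr Jxy|].
  exact: joined_trans Jr (joined_sym symK Jxy).
by congr (epsilon _ _); apply: proof_irrelevance.
Qed.

(** Closing both walks by the same return walk [w] shows that each ratio is the
    inverse of the ratio along [w]. *)
Lemma walk_ratio_unique X (F : fieldType) (K Q : X -> X -> F) r u v :
  symmetric_kernel K -> symmetric_kernel Q -> equivalent_kernels K Q ->
  last r u = last r v -> walk_weight K r u != 0 -> walk_weight K r v != 0 ->
  walk_weight Q r u / walk_weight K r u = walk_weight Q r v / walk_weight K r v.
Proof.
move=> symK symQ eqKQ euv wu wv.
have [w [wr ww]] : joined K (last r u) r.
  by apply: joined_sym => //; exists u.
have wQ : walk_weight Q (last r u) w != 0.
  rewrite -sqrf_eq0 -(@walk_weight_sqr _ _ K) ?sqrf_eq0 // => y z.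
  exact: equivalent_sqr.
have close t : last r t = last r u -> walk_weight K r t != 0 ->
    walk_weight Q r t / walk_weight K r t =
    walk_weight K (last r u) w / walk_weight Q (last r u) w.
  move=> et wt; apply/eqP; rewrite eqr_div //; apply/eqP.
  have := @closed_walk_weight _ _ K Q r (t ++ w) symK symQ eqKQ.
  by rewrite last_cat !walk_weight_cat et wr => <- //; rewrite mulrC.
by rewrite !close.
Qed.

(** Appending an edge from [x] to [y] to a walk ending at [x] multiplies the
    ratio by [Q x y / K x y], so [g y = g x * (Q x y / K x y)]; as [g] takes
    only the values 1 and -1, this rearranges to the required identity. *)
Lemma equivalent_signs X (F : fieldType) (K Q : X -> X -> F) :
  symmetric_kernel K -> symmetric_kernel Q -> equivalent_kernels K Q ->
  exists g : X -> F, (forall x, g x = 1 \/ g x = - 1) /\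
    (forall x y, Q x y = g x * (g y)^-1 * K x y).
Proof.
move=> symK symQ eqKQ; have [r [rP r_eq]] := joined_root symK.
pose walk x := proj1_sig (constructive_indefinite_description _ (rP x)).
have walkP x : last (r x) (walk x) = x /\ walk_weight K (r x) (walk x) != 0.
  by rewrite /walk; case: constructive_indefinite_description.
pose g x := walk_weight Q (r x) (walk x) / walk_weight K (r x) (walk x).
have sq x y := equivalent_sqr x y symK symQ eqKQ.
have gP x : g x = 1 \/ g x = - 1.
  have : g x ^+ 2 == 1.
    by rewrite expr_div_n -(walk_weight_sqr _ _ sq) divff // sqrf_eq0 (walkP x).2.
  by rewrite sqrf_eq1 => /orP[] /eqP; [left|right].
exists g; split=> // x y.
have gV z : (g z)^-1 = g z by case: (gP z) => ->; rewrite ?invrN invr1.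
have gg z : g z * g z = 1 by case: (gP z) => ->; rewrite ?mulrNN mulr1.
have [Kxy|Kxy] := eqVneq (K x y) 0.
  by apply/eqP; rewrite Kxy mulr0 -sqrf_eq0 -sq Kxy expr0n.
have [lx wx] := walkP x; have [ly wy] := walkP y.
have rxy : r y = r x by rewrite (r_eq x y) //; apply: joined_edge.
have -> : g y = g x * (Q x y / K x y).
  rewrite /g rxy (@walk_ratio_unique _ _ K Q _ _ (rcons (walk x) y)) //.
  - by rewrite -cats1 !walk_weight_cat lx /= !mulr1 mulf_div.
  - by rewrite -{1}rxy ly last_rcons.
  - by rewrite -rxy.
  - by rewrite -cats1 walk_weight_cat lx /= mulr1 mulf_neq0.
have QK : Q x y / K x y * (Q x y / K x y) = 1.
  by rewrite -expr2 expr_div_n sq divff // -sq sqrf_eq0.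
rewrite invfM gV mulrA gg mul1r invf_div.
have Qxy : Q x y != 0 by rewrite -sqrf_eq0 -sq sqrf_eq0.
by apply: (mulIf Qxy); rewrite mulrAC divfK // -!expr2 sq.
Qed.

(** The factors [g x_i] and [(g x_(s i))^-1] cancel in each Leibniz term. *)
Lemma det_conj_kernel X (F : fieldType) (K Q : X -> X -> F) (g : X -> F) n
    (t : n.-tuple X) :
  (forall x, g x != 0) -> (forall x y, Q x y = g x * (g y)^-1 * K x y) ->
  \det (kernel_matrix Q t) = \det (kernel_matrix K t).
Proof.
move=> g0 QE; apply: eq_bigr => s _; congr (_ * _).
under eq_bigr do rewrite mxE QE.
have gs : \prod_i (g (tnth t (s i)))^-1 = \prod_i (g (tnth t i))^-1.
  by rewrite [RHS](reindex_inj (@perm_inj _ s)).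
rewrite !big_split /= gs.
rewrite -big_split big1 ?mul1r => [|i _]; last by rewrite /= divff.
by apply: eq_bigr => i _; rewrite mxE.
Qed.

Theorem theorem1p5 (X : Type) (F : fieldType) (K Q : X -> X -> F)
    (symK : symmetric_kernel K) (symQ : symmetric_kernel Q) :
  equivalent_kernels K Q <->
  exists g : X -> F,
    (forall x : X, g x = 1 \/ g x = - 1) /\
    (forall x y : X, Q x y = g x * (g y)^-1 * K x y).
Proof.
split=> [|[g [gP QE]] n t _]; first exact: equivalent_signs.
rewrite (det_conj_kernel t _ QE) // => x.
by case: (gP x) => ->; rewrite ?oppr_eq0 oner_neq0.
Qed.
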